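(* Let $(V,\langle\cdot,\cdot\rangle)$ be an inner product space with induced norm $\|\cdot\|$ and let $u,v\in V$. (i) For every $\tau\in\mathcal S_0$, $\ \tau(\|u\|)-\tau(\|v\|)\le \|u-v\|\,\tau'(\|u+v\|)$. (ii) For every $\alpha\in[1,2]$, $\ \|u\|^\alpha-\|v\|^\alpha\le \alpha\,2^{1-\alpha}\,\|u-v\|\,\|u+v\|^{\alpha-1}$. (iii) For every $\tau\in\mathcal S_0$, $\ \tau(\|u+v\|)+\tau(\|u-v\|)\le 2\tau(\|u\|)+2\tau(\|v\|)$. (iv) For every $\alpha\in[1,2]$, $\ \|u+v\|^\alpha+\|u-v\|^\alpha\le 2\|u\|^\alpha+2\|v\|^\alpha$.
   Context: $\mathcal S$ is the set of nondecreasing, convex functions $\tau\colon[0,\infty)\to\mathbb R$ that are differentiable on $(0,\infty)$ with concave derivative $\tau'$; $\tau'$ is extended to $0$ by $\tau'(0):=\lim_{x\searrow0}\tau'(x)$. $\mathcal S_0:=\{\tau\in\mathcal S:\tau(0)=0\}$. *)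

(* Defs.v *)
From HB Require Import structures.
From mathcomp Require Import all_boot all_order all_algebra.
From mathcomp Require Import sesquilinear complex.
From mathcomp Require Import all_classical all_reals all_analysis.
Set Implicit Arguments.
Unset Strict Implicit.
Unset Printing Implicit Defensive.
Import Order.TTheory GRing.Theory Num.Theory.
Import numFieldNormedType.Exports.
Local Open Scope classical_set_scope.
Local Open Scope ring_scope.

(* An inner product space is either real or complex. *)
Inductive scalar_kind := RealScalars | ComplexScalars.

Definition scalar_field (R : realType) (k : scalar_kind) : numFieldType :=
  match k with
  | RealScalars => R
  | ComplexScalars => R[i]
  end.

Definition scalar_conj (R : realType) (k : scalar_kind) :
    scalar_field R k -> scalar_field R k :=
  match k with
  | RealScalars => idfun
  | ComplexScalars => @Num.conj R[i]
  end.

Definition scalar_Re (R : realType) (k : scalar_kind) : scalar_field R k -> R :=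
  match k with
  | RealScalars => idfun
  | ComplexScalars => @complex.Re R
  end.

(* {dot V for scalar_conj} is the type of positive definite forms on V, linear
   in the first argument and hermitian (symmetric in the real case); `ip u u`
   is a nonnegative real scalar, and taking its real part only changes its
   type. *)
Definition ipnorm (R : realType) (k : scalar_kind) (V : lmodType (scalar_field R k))
    (ip : {dot V for (@scalar_conj R k)}) (u : V) : R :=
  Num.sqrt (scalar_Re (ip u u)).

(* A function [0, +oo[ -> R is represented by a function R -> R, whose values
   at negative arguments play no role: only its restriction to [0, +oo[, and
   its derivative on the open set ]0, +oo[, are used. *)
Definition calS (R : realType) : set (R -> R) := [set tau : R -> R |
  [/\ {in `[0, +oo[ &, {homo tau : x y / x <= y}},
      @convex_function R R^o `[0, +oo[%classic tau,
      {in `]0, +oo[, forall x, derivable tau x 1} &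
      @convex_function R R^o `]0, +oo[%classic (fun x => - (tau^`())%classic x)]].

Definition calS0 (R : realType) : set (R -> R) :=
  @calS R `&` [set tau : R -> R | tau 0 = 0].

(* tau' extended to 0 by its right limit there *)
Definition deriv_ext (R : realType) (tau : R -> R) (x : R) : R :=
  if x == 0 then lim ((tau^`())%classic y @[y --> 0^'+]) else (tau^`())%classic x.

(* Main.v *)
Require Import Defs.
From mathcomp Require Import all_boot all_order all_algebra.
From mathcomp Require Import sesquilinear complex.
From mathcomp Require Import all_classical all_reals all_analysis.
From mathcomp Require Import ring lra.
Import Order.TTheory GRing.Theory Num.Theory.
Import numFieldNormedType.Exports.

(** Only four lengths matter: a, b are the norms of u, v and s, d those of
    u + v, u - v. They satisfy the parallelogram law
    s^2 + d^2 = 2 (a^2 + b^2) and, by Cauchy-Schwarz,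
    |s^2 - d^2| <= 4 a b. The scalar field enters only through these two facts
    ([ipnorm_parallelogram], [ipnorm_polarization_le]), and they give
    s <= a + b and (a - b) (a + b) <= d s.

    On ]0, +oo[ the derivative g of a function tau of the class is nonnegative
    and concave, hence nondecreasing, and g x / x is nonincreasing.

    Parts (i) and (ii) both follow from the sharper bound
      tau a - tau b <= d g (s / 2)    for s > 0    ([calS_quadruple]).
    For b <= a, concavity of g gives the midpoint rule
    tau a - tau b <= (a - b) g ((a + b) / 2) ([calS_midpoint]). Since
    s / 2 <= (a + b) / 2, passing from the point (a + b) / 2 to s / 2 costs at
    most the factor (a + b) / s, by monotonicity of g x / x, and
    (a - b) (a + b) / s <= d. Part (i) then uses g (s / 2) <= g s, and part
    (ii) is the case tau x = x^alpha, where
    g (s / 2) = alpha 2^(1 - alpha) s^(alpha - 1). If s = 0, then a = b and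
    the left-hand sides vanish.

    Parts (iii) and (iv) say that phi y = tau (sqrt y) is concave with
    phi 0 = 0, its derivative being g x / (2 x) at y = x^2. Thus
    phi (s^2) + phi (d^2) <= 2 phi ((s^2 + d^2) / 2) = 2 phi (a^2 + b^2)
    <= 2 phi (a^2) + 2 phi (b^2). Both inequalities are instances of one
    monotonicity statement, [calS_hypot_sub_nincr]. Part (iv) is (iii) for the
    powers, which belong to the class by [calS0_powR]. *)

Set Implicit Arguments.
Unset Strict Implicit.
Unset Printing Implicit Defensive.
Local Open Scope classical_set_scope.
Local Open Scope ring_scope.

(** * Norms in a real or complex inner product space *)

Definition scalar_of {R : realType} (k : scalar_kind) : R -> scalar_field R k :=
  match k with
  | RealScalars => idfun
  | ComplexScalars => real_complex R
  end.

Section InnerProduct.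
Context {R : realType} {k : scalar_kind} {V : lmodType (scalar_field R k)}.
Variable ip : {dot V for (@scalar_conj R k)}.
Implicit Types u v w : V.

Lemma scalar_ReD : {morph @scalar_Re R k : x y / x + y}.
Proof. by case: k => // -[a b] [c d]. Qed.

Lemma scalar_ReM_of (r : R) x : scalar_Re (scalar_of k r * x) = r * scalar_Re x.
Proof. by case: k x => //= -[a b] /=; ring. Qed.

Lemma scalar_Re_conj x : scalar_Re (@scalar_conj R k x) = scalar_Re x.
Proof. by case: k x => // -[a b]. Qed.

Lemma scalar_Re_ge0 x : 0 <= x -> 0 <= @scalar_Re R k x.
Proof. by case: k x => // -[a b]; rewrite lecE => /andP[]. Qed.

Definition re_ip u v : R := scalar_Re (ip u v).

Lemma re_ipC u v : re_ip u v = re_ip v u.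
Proof. by rewrite /re_ip hermitian_subproof mul1r scalar_Re_conj. Qed.

Lemma re_ipDl u v w : re_ip (u + v) w = re_ip u w + re_ip v w.
Proof. by rewrite /re_ip linearDl scalar_ReD. Qed.

Lemma re_ipDr u v w : re_ip w (u + v) = re_ip w u + re_ip w v.
Proof. by rewrite !(re_ipC w) re_ipDl. Qed.

Lemma re_ipZl r u v : re_ip (scalar_of k r *: u) v = r * re_ip u v.
Proof. by rewrite /re_ip linearZl_LR scalar_ReM_of. Qed.

Lemma re_ipZr r u v : re_ip v (scalar_of k r *: u) = r * re_ip v u.
Proof. by rewrite !(re_ipC v) re_ipZl. Qed.

Lemma re_ipNl u v : re_ip (- u) v = - re_ip u v.
Proof.
apply/eqP; rewrite -addr_eq0 -re_ipDl addNr /re_ip linear0l.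
by case: k.
Qed.

Lemma re_ipNr u v : re_ip v (- u) = - re_ip v u.
Proof. by rewrite !(re_ipC v) re_ipNl. Qed.

Lemma re_ip_ge0 u : 0 <= re_ip u u.
Proof.
apply: scalar_Re_ge0; have [->|u0] := eqVneq u 0; first by rewrite linear0l.
exact/ltW/neq0_dnorm_gt0.
Qed.

(** Real scalars suffice: the form x, y |-> |x u + y v|^2 is nonnegative, so
    its discriminant is nonpositive. *)
Lemma re_ip_CauchySchwarz u v : re_ip u v ^+ 2 <= re_ip u u * re_ip v v.
Proof.
set A := re_ip u u; set D := re_ip v v; set c := re_ip u v.
have quad x y : 0 <= x ^+ 2 * A + 2 * (x * y) * c + y ^+ 2 * D.
  have := re_ip_ge0 (scalar_of k x *: u + scalar_of k y *: v).
  rewrite re_ipDl !re_ipDr !re_ipZl !re_ipZr (re_ipC v u) -/A -/c -/D.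
  by congr (_ <= _); ring.
have A0 : 0 <= A := re_ip_ge0 u.
have : 0 <= D := re_ip_ge0 v.
rewrite le_eqVlt => /predU1P[D0|D0]; last first.
  (* At (D, - c) the quadratic form is D (A D - c^2). *)
  rewrite -subr_ge0 -(pmulr_rge0 _ D0).
  by have := quad D (- c); congr (_ <= _); ring.
(* If D = 0, the form at (c, - (A + 1)) is - (A + 2) c^2, so c = 0. *)
have := quad c (- (A + 1)); rewrite -D0.
rewrite [X in 0 <= X](_ : _ = - ((A + 2) * c ^+ 2)); last by ring.
by rewrite mulr0 oppr_ge0 pmulr_rle0//; lra.
Qed.

Lemma sqr_ipnorm u : ipnorm ip u ^+ 2 = re_ip u u.
Proof. by rewrite sqr_sqrtr// re_ip_ge0. Qed.

Lemma ipnorm_parallelogram u v :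
  ipnorm ip (u + v) ^+ 2 + ipnorm ip (u - v) ^+ 2 =
  2 * (ipnorm ip u ^+ 2 + ipnorm ip v ^+ 2).
Proof.
by rewrite !sqr_ipnorm !re_ipDl !re_ipDr !re_ipNl !re_ipNr (re_ipC v u); ring.
Qed.

(** The left-hand side is 4 |Re <u, v>|. *)
Lemma ipnorm_polarization_le u v :
  `|ipnorm ip (u + v) ^+ 2 - ipnorm ip (u - v) ^+ 2| <=
  4 * (ipnorm ip u * ipnorm ip v).
Proof.
rewrite !sqr_ipnorm !re_ipDl !re_ipDr !re_ipNl !re_ipNr (re_ipC v u).
rewrite [X in `|X|](_ : _ = 4 * re_ip u v); last by ring.
rewrite normrM ger0_norm// ler_pM2l//.
rewrite -(@ler_pXn2r _ 2) ?nnegrE ?mulr_ge0 ?sqrtr_ge0//.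
by rewrite exprMn !sqr_ipnorm real_normK ?num_real// re_ip_CauchySchwarz.
Qed.

End InnerProduct.

(** * The four lengths of a parallelogram *)

Section ParallelogramSides.
Context {R : realType}.
Variables a b s d : R.
Hypotheses (a0 : 0 <= a) (b0 : 0 <= b) (s0 : 0 <= s) (d0 : 0 <= d).
Hypothesis para : s ^+ 2 + d ^+ 2 = 2 * (a ^+ 2 + b ^+ 2).
Hypothesis polar : `|s ^+ 2 - d ^+ 2| <= 4 * (a * b).

Lemma diagonal_le_sum : s <= a + b.
Proof.
move: polar; rewrite ler_norml => /andP[_ ?].
rewrite -(@ler_pXn2r _ 2) ?nnegrE ?addr_ge0//.
by move: para; lra.
Qed.

(** If s = 0, then 2 (a^2 + b^2) = d^2 <= 4 a b, that is (a - b)^2 <= 0. *)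
Lemma eq_sides : s = 0 -> a = b.
Proof.
move=> s_eq0; have h : (a - b) ^+ 2 <= 0.
  move: para polar; rewrite s_eq0 expr0n/= add0r sub0r normrN.
  by rewrite ger0_norm ?sqr_ge0//; lra.
by apply/eqP; rewrite -subr_eq0 -sqrf_eq0 eq_le h sqr_ge0.
Qed.

(** With the sum of s^2 and d^2 given, 4 s^2 d^2 is the square of that sum
    minus (s^2 - d^2)^2, which is at most 16 a^2 b^2. *)
Lemma mul_diagonals_ge : (a - b) * (a + b) <= d * s.
Proof.
rewrite (le_trans (ler_norm _))//.
rewrite -(@ler_pXn2r _ 2) ?nnegrE ?mulr_ge0// real_normK ?num_real//.
have : (s ^+ 2 - d ^+ 2) ^+ 2 <= (4 * (a * b)) ^+ 2.
  rewrite -[leLHS]real_normK ?num_real//.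
  by rewrite ler_pXn2r ?nnegrE ?mulr_ge0.
have : (s ^+ 2 + d ^+ 2) ^+ 2 = (2 * (a ^+ 2 + b ^+ 2)) ^+ 2 by rewrite para.
lra.
Qed.

End ParallelogramSides.

(** * Concave functions and continuity at the origin *)

Section ClassS.
Context {R : realType}.
Implicit Types (g tau : R -> R) (a b x y : R).

Lemma convexR_le (D : set R) (f : R -> R) : @convex_function R R^o D f ->
  forall t x y, 0 <= t <= 1 -> D x -> D y ->
  f (t * x + (1 - t) * y) <= t * f x + (1 - t) * f y.
Proof.
move=> cf t x y /andP[t0 t1] Dx Dy.
have := cf (Itv01 t0 t1) x y; rewrite !inE => /(_ Dx Dy).
by rewrite !convRE.
Qed.

Section PositiveConcave.
Variable g : R -> R.
Hypothesis g0 : forall x, 0 < x -> 0 <= g x.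
Hypothesis gconc : forall t x y, 0 <= t <= 1 -> 0 < x -> 0 < y ->
  t * g x + (1 - t) * g y <= g (t * x + (1 - t) * y).

Lemma concave_three_points x y z : 0 < x -> x < y -> y < z ->
  (z - y) * g x + (y - x) * g z <= (z - x) * g y.
Proof.
move=> x0 xy yz; have zx : 0 < z - x by lra.
have t01 : 0 <= (z - y) / (z - x) <= 1.
  by rewrite ler_pdivrMr// mul1r divr_ge0/=; lra.
have := gconc t01 x0 (lt_trans x0 (lt_trans xy yz)).
have -> : (z - y) / (z - x) * x + (1 - (z - y) / (z - x)) * z = y.
  by field; rewrite gt_eqF.
rewrite -(ler_pM2l zx); congr (_ <= _).
by field; rewrite gt_eqF.
Qed.

(** A nonnegative concave function on a half-line cannot decrease: a chord of
    negative slope, prolonged far enough, would pass below 0. *)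
Lemma concave_ge0_ndecr x y : 0 < x -> x <= y -> g x <= g y.
Proof.
move=> x0; rewrite le_eqVlt => /predU1P[->//|xy].
rewrite leNgt; apply/negP => gyx.
(* The line through (x, g x) and (y, g y) takes the value - 1 at z. *)
pose z := y + (g y + 1) * (y - x) / (g x - g y).
have gd : 0 < g x - g y by rewrite subr_gt0.
have gy0 : 0 <= g y by rewrite g0// (lt_trans x0).
have zy : z - y = (g y + 1) * (y - x) / (g x - g y) by rewrite /z; ring.
have yz : y < z by rewrite -subr_gt0 zy divr_gt0 ?mulr_gt0 ?subr_gt0//; lra.
have := concave_three_points x0 xy yz.
have gz : 0 <= (y - x) * g z.
  by rewrite mulr_ge0 ?g0 ?subr_ge0 1?ltW// (lt_trans x0)// (lt_trans xy).
have : (z - y) * (g x - g y) = (g y + 1) * (y - x).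
  by rewrite zy; field; rewrite gt_eqF.
nra.
Qed.

(** The chord from (w, g w) to (y, g y) stays below g at x, and g w >= 0;
    letting w tend to 0 gives g x >= (x / y) g y. *)
Lemma concave_ge0_ratio x y : 0 < x -> x <= y -> x * g y <= y * g x.
Proof.
move=> x0; rewrite le_eqVlt => /predU1P[->//|xy].
apply/ler_addgt0Pr => e e0.
have y0 := lt_trans x0 xy.
have gy0 := g0 y0.
(* w < x keeps the order of the three points, and w (g y + 1) <= e bounds the
   error w g y of the chord estimate. *)
pose w := Num.min (x / 2) (e / (g y + 1)).
have wx : w <= x / 2 by rewrite ge_min lexx.
have we : w * (g y + 1) <= e by rewrite -ler_pdivlMr ?ge_min ?lexx ?orbT//; lra.
have w0 : 0 < w by rewrite lt_min !divr_gt0//; lra.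
have := @concave_three_points w x y w0 _ xy.
have := g0 w0; have := g0 x0.
nra.
Qed.
End PositiveConcave.

Lemma ndecr_derive1_ge0 tau x : {in `[0, +oo[ &, {homo tau : x y / x <= y}} ->
  derivable tau x 1 -> 0 < x -> 0 <= (tau^`())%classic x.
Proof.
move=> taund taud x0; rewrite derive1E; apply: limr_ge => //.
have : \forall h \near (0 : R)^', `|h| < x.
  by apply: dnbhs0_lt.
apply: filterS => h; rewrite ltr_norml => /andP[hx _].
rewrite /= [h%:A]mulr1 /GRing.scale/=; have [h0|h0] := leP 0 h.
  by rewrite mulr_ge0 ?invr_ge0// subr_ge0 taund ?in_itv/= ?andbT//; lra.
rewrite mulr_le0// ?invr_le0 ?subr_le0 ?(ltW h0)//.
by rewrite taund ?in_itv/= ?andbT//; lra.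
Qed.

(** Convexity alone allows tau 0 to exceed the right limit there; monotonicity
    excludes it, since tau 0 <= tau x <= tau 0 + x (tau 1 - tau 0) near 0. This
    lets the derivative tests below start at 0, where tau need not be
    differentiable. *)
Lemma convex_ndecr_continuous tau : calS tau ->
  {within `[0, +oo[, continuous tau}.
Proof.
move=> [taund taucvx taud _]; apply/continuous_within_itvcyP; split.
  by move=> x /taud/derivable1_diffP/differentiable_continuous.
apply: (@squeeze_cvgr _ _ _ _ (cst (tau 0))
  (fun x => tau 0 + x * (tau 1 - tau 0))).
- near=> x.
  have x0 : 0 < x by near: x; exact: nbhs_right_gt.
  have x1 : x < 1 by near: x; exact: nbhs_right_lt.
  apply/andP; split; first by rewrite taund ?in_itv/= ?lexx ?ltW.
  have := @convexR_le _ _ taucvx x 1 0.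
  rewrite !mulr0 mulr1 addr0 /= !in_itv/= ler01 lexx (ltW x0) (ltW x1).
  by move=> /(_ _ _ _)/le_trans; apply => //; lra.
- exact: cvg_cst.
- rewrite -[X in _ --> X]addr0 -[X in _ --> _ + X](mul0r (tau 1 - tau 0)).
  apply: cvgD; first exact: cvg_cst.
  by apply: cvgMl; apply: cvg_at_right_filter; exact: cvg_id.
Unshelve. all: by end_near. Qed.
End ClassS.

(** * Inequalities for the class S *)

Section Inequalities.
Context {R : realType}.
Variable tau : R -> R.
Hypothesis Stau : calS tau.
Implicit Types a b c d h s x y z m : R.

Local Notation dtau := ((tau^`())%classic).

Let tau_ndecr x y : 0 <= x -> x <= y -> tau x <= tau y.
Proof.
by have [h _ _ _] := Stau => x0 xy; rewrite h ?in_itv/= ?andbT// (le_trans x0).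
Qed.

Lemma calS_is_derive x : 0 < x -> is_derive x 1 tau (dtau x).
Proof.
move=> x0; rewrite derive1E; apply/derivableP.
by have [_ _ h _] := Stau; apply: h; rewrite in_itv/= andbT.
Qed.

Lemma calS_derive_ge0 x : 0 < x -> 0 <= dtau x.
Proof.
move=> x0; apply: ndecr_derive1_ge0 => //; first by have [] := Stau.
exact: (@ex_derive _ _ _ _ _ _ _ (calS_is_derive x0)).
Qed.

Lemma calS_derive_concave t x y : 0 <= t <= 1 -> 0 < x -> 0 < y ->
  t * dtau x + (1 - t) * dtau y <= dtau (t * x + (1 - t) * y).
Proof.
move=> t01 x0 y0; have [_ _ _ /convexR_le/(_ t x y t01)] := Stau.
by rewrite /= !in_itv/= !andbT => /(_ x0 y0); lra.
Qed.

Lemma calS_derive_ndecr x y : 0 < x -> x <= y -> dtau x <= dtau y.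
Proof. exact: concave_ge0_ndecr calS_derive_ge0 calS_derive_concave x y. Qed.

Lemma calS_derive_ratio x y : 0 < x -> x <= y -> x * dtau y <= y * dtau x.
Proof. exact: concave_ge0_ratio calS_derive_ge0 calS_derive_concave x y. Qed.

Lemma calS_within_continuous m : {within `[0, m], continuous tau}.
Proof.
apply: continuous_subspaceW (convex_ndecr_continuous Stau).
by move=> x /=; rewrite !in_itv/= andbT => /andP[].
Qed.

(** With m the midpoint, F x = tau (2 m - x) - tau x + 2 g(m) x has derivative
    2 g m - g (2 m - x) - g x >= 0 on ]0, m[ by concavity of g = tau', so
    F b <= F m. *)
Lemma calS_midpoint a b : 0 <= b -> b <= a ->
  tau a - tau b <= (a - b) * dtau ((a + b) / 2).
Proof.
move=> b0; rewrite le_eqVlt => /predU1P[->|ba]; first by rewrite !subrr mul0r.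
set m := (a + b) / 2.
have m0 : 0 < m by rewrite /m; lra.
pose refl (x : R) := 2 * m - x.
pose lin (x : R) := 2 * dtau m * x.
have refl_derive (x : R) : is_derive x 1 refl (- 1).
  by apply: is_derive_eq; ring.
have tr_derive x : x <= m -> is_derive x 1 (tau \o refl) (dtau (refl x) * -1).
  move=> xm; apply: is_derive1_comp.
  by apply: calS_is_derive; rewrite /refl; lra.
have lin_derive x : is_derive x 1 lin (2 * dtau m).
  by apply: is_derive_eq; rewrite [LHS]mulr1.
pose F := tau \o refl - tau + lin.
have F_derive x : x \in `]0, m[ ->
    is_derive x 1 F (dtau (refl x) * -1 - dtau x + 2 * dtau m).
  rewrite in_itv/= => /andP[x0 xm].
  have := calS_is_derive x0; have := tr_derive _ (ltW xm).
  by move=> *; exact: is_deriveD.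
have F_cont : {within `[0, m], continuous F}.
  apply: within_continuousD; first apply: within_continuousB.
  - apply: derivable_within_continuous => x; rewrite in_itv/= => /andP[_ xm].
    by have /@ex_derive := tr_derive _ xm.
  - exact: calS_within_continuous.
  - apply: derivable_within_continuous => x _.
    by have /@ex_derive := lin_derive x.
have F_ge0 x : x \in `]0, m[ -> 0 <= (F^`())%classic x.
  move=> xm; rewrite derive1E (@derive_val _ _ _ _ _ _ _ (F_derive _ xm)).
  move: xm; rewrite in_itv/= => /andP[x0 xm].
  have half : 0 <= (1 : R) / 2 <= 1 by lra.
  have rx : 0 < refl x by rewrite /refl; lra.
  have := calS_derive_concave half rx x0.
  rewrite (_ : 1 / 2 * refl x + _ * x = m); first by lra.
  by rewrite /refl; field.
have := @ger0_derive1_ndecr _ F 0 m _ F_ge0 F_cont b m b0 _ (lexx m).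
have bm : b <= m by rewrite /m; lra.
move=> /(_ _ bm).
have -> : F b = tau a - tau b + 2 * dtau m * b.
  by rewrite /F /lin /refl !fctE/=; congr (tau _ - _ + _); rewrite /m; field.
have -> : F m = (a + b) * dtau m.
  rewrite /F /lin /refl !fctE/= (_ : 2 * m - m = m); last by ring.
  by rewrite subrr add0r /m; field.
move=> h; have : tau a - tau b + 2 * dtau m * b <= (a + b) * dtau m.
  by apply: h => x xm; have /@ex_derive := F_derive _ xm.
by lra.
Qed.

(** Concavity of y |-> tau (sqrt y), without dividing by the square root at 0:
    its increment over a step c decreases. With r = sqrt (c + z^2) >= z, the
    derivative in z of tau r - tau z is z (tau' r / r - tau' z / z) <= 0. *)
Lemma calS_hypot_sub_nincr c x y : 0 < c -> 0 <= x -> x <= y ->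
  tau (Num.sqrt (c + y ^+ 2)) - tau y <= tau (Num.sqrt (c + x ^+ 2)) - tau x.
Proof.
move=> c0 x0 xy.
pose q (z : R) := c + z ^+ 2.
pose r := Num.sqrt \o q.
have q0 z : 0 < q z by rewrite ltr_wpDr// sqr_ge0.
have r0 z : 0 < r z by rewrite sqrtr_gt0.
have q_derive z : is_derive z 1 q (2 * z).
  by apply: is_derive_eq; rewrite /GRing.scale/=; ring.
have r_derive z : is_derive z 1 r (z / r z).
  apply: (is_derive_eq (is_derive1_comp (is_derive1_sqrt (q0 z)) (q_derive z))).
  by rewrite /r/=; field; rewrite gt_eqF// r0.
have tr_derive z : is_derive z 1 (tau \o r) (dtau (r z) * (z / r z)).
  exact: is_derive1_comp (calS_is_derive (r0 z)) (r_derive z).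
pose F := tau \o r - tau.
have F_derive z : 0 < z -> is_derive z 1 F (dtau (r z) * (z / r z) - dtau z).
  move=> z0; have := calS_is_derive z0; have := tr_derive z.
  by move=> *; exact: is_deriveB.
have := @ler0_derive1_nincry _ F 0 _ _ _ x y x0 xy; apply.
- by move=> z; rewrite in_itv/= andbT => /F_derive/@ex_derive.
- move=> z; rewrite in_itv/= andbT => z0.
  rewrite derive1E (@derive_val _ _ _ _ _ _ _ (F_derive _ z0)) subr_le0.
  rewrite mulrA ler_pdivrMr//.
  have zr : z <= r z.
    rewrite -[leLHS](ger0_norm (ltW z0)) -sqrtr_sqr.
    by rewrite ler_wsqrtr// /q lerDr ltW.
  by have := calS_derive_ratio z0 zr; lra.
- apply: within_continuousB; last exact: convex_ndecr_continuous Stau.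
  by apply: derivable_within_continuous => z _; have /@ex_derive := tr_derive z.
Qed.

(** The comparison of [tau'] at (a + b) / 2 and at s / 2 loses the factor
    (a + b) / s, which (a - b) (a + b) <= d s absorbs. *)
Lemma calS_quadruple a b s d :
  0 <= a -> 0 <= b -> 0 < s -> 0 <= d ->
  s ^+ 2 + d ^+ 2 = 2 * (a ^+ 2 + b ^+ 2) ->
  `|s ^+ 2 - d ^+ 2| <= 4 * (a * b) ->
  tau a - tau b <= d * dtau (s / 2).
Proof.
move=> a0 b0 s0 d0 para polar.
have hs0 : 0 < s / 2 by lra.
have g0 := calS_derive_ge0 hs0.
have [ab|ba] := leP a b.
  by rewrite (@le_trans _ _ 0) ?mulr_ge0// subr_le0 tau_ndecr.
apply: (le_trans (calS_midpoint b0 (ltW ba))).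
have sab := diagonal_le_sum a0 b0 (ltW s0) para polar.
have ds := mul_diagonals_ge a0 b0 (ltW s0) d0 para polar.
have := @calS_derive_ratio (s / 2) ((a + b) / 2) hs0.
move=> /(_ ltac:(lra)); set gm := dtau ((a + b) / 2).
set gs := dtau (s / 2) => ratio.
rewrite -(ler_pM2l hs0).
rewrite (@le_trans _ _ ((a - b) * ((a + b) / 2 * gs)))//.
  by rewrite mulrCA ler_wpM2l// subr_ge0 ltW.
by have := ler_wpM2r g0 ds; rewrite -/gs; lra.
Qed.

Hypothesis tau0 : tau 0 = 0.

(** Subadditivity of y |-> tau (sqrt y): the increment over a^2 from b^2 is at
    most the one from 0. *)
Lemma calS0_hypot_le a b : 0 <= a -> 0 <= b ->
  tau (Num.sqrt (a ^+ 2 + b ^+ 2)) <= tau a + tau b.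
Proof.
rewrite le_eqVlt => /predU1P[<-|a0] b0.
  by rewrite expr0n add0r sqrtr_sqr ger0_norm// tau0 add0r.
have := calS_hypot_sub_nincr (exprn_gt0 2 a0) (lexx 0) b0.
by rewrite expr0n addr0 sqrtr_sqr gtr0_norm// tau0; lra.
Qed.

(** Midpoint concavity of y |-> tau (sqrt y): the squares of d, m, s are in
    arithmetic progression, with step c. *)
Lemma calS_quadratic_mean s d : 0 <= s -> 0 <= d ->
  tau s + tau d <= 2 * tau (Num.sqrt ((s ^+ 2 + d ^+ 2) / 2)).
Proof.
wlog ds : s d / d <= s => [hwlog s0 d0|s0 d0].
  have [/hwlog|/ltW/hwlog] := leP d s; first exact.
  by rewrite addrC [d ^+ 2 + _]addrC; apply.
set m := Num.sqrt _.
have m2 : m ^+ 2 = (s ^+ 2 + d ^+ 2) / 2.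
  by rewrite sqr_sqrtr// divr_ge0// addr_ge0// sqr_ge0.
move: ds; rewrite le_eqVlt => /predU1P[dsE|ds].
  have -> : m = s; last by rewrite dsE; lra.
  rewrite /m dsE (_ : (_ + _) / 2 = s ^+ 2); last by field.
  by rewrite sqrtr_sqr ger0_norm.
have c0 : 0 < (s ^+ 2 - d ^+ 2) / 2 by rewrite divr_gt0// subr_gt0 ltrXn2r.
have dm : d <= m.
  rewrite -[leLHS](ger0_norm d0) -sqrtr_sqr ler_wsqrtr//.
  by move: c0; lra.
have := calS_hypot_sub_nincr c0 d0 dm.
rewrite (_ : _ + m ^+ 2 = s ^+ 2); last by rewrite m2; field.
rewrite (_ : _ + d ^+ 2 = m ^+ 2); last by rewrite m2; field.
by rewrite !sqrtr_sqr (ger0_norm s0) (ger0_norm (sqrtr_ge0 _)); lra.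
Qed.

Lemma calS0_parallelogram a b s d :
  0 <= a -> 0 <= b -> 0 <= s -> 0 <= d ->
  s ^+ 2 + d ^+ 2 = 2 * (a ^+ 2 + b ^+ 2) ->
  tau s + tau d <= 2 * tau a + 2 * tau b.
Proof.
move=> a0 b0 s0 d0 para; apply: (le_trans (calS_quadratic_mean s0 d0)).
rewrite para (_ : _ / 2 = a ^+ 2 + b ^+ 2); last by field.
by have := calS0_hypot_le a0 b0; lra.
Qed.

(** At 0, the limit exists because tau' is nondecreasing and bounded below. *)
Lemma deriv_ext_ge0 x : 0 <= x -> 0 <= deriv_ext tau x.
Proof.
rewrite /deriv_ext; have [->|x0] := eqVneq x 0 => [_|x_ge0]; last first.
  by rewrite calS_derive_ge0// lt_def x0.
apply: limr_ge.
  apply: nondecreasing_at_right_is_cvgr; near=> y.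
    move=> z t; rewrite !in_itv/= => /andP[z0 _] _.
    exact: calS_derive_ndecr.
  exists 0 => _ [z zy <-]; apply: calS_derive_ge0.
  by move: zy; rewrite /= in_itv/= => /andP[].
near=> y; apply: calS_derive_ge0; near: y; exact: nbhs_right_gt.
Unshelve. all: by end_near. Qed.

End Inequalities.

(** * Powers *)

Section Powers.
Context {R : realType}.
Implicit Types p x y t : R.

(** Apply the convex power 1 / p to x^p and y^p, then raise to the power p. *)
Lemma concave_powR p t x y : 0 <= p <= 1 -> 0 <= t <= 1 -> 0 <= x -> 0 <= y ->
  t * x `^ p + (1 - t) * y `^ p <= (t * x + (1 - t) * y) `^ p.
Proof.
move=> /andP[p0 p1] t01 x0 y0; move: (t01) => /andP[t0 t1].
have t1' : 0 <= 1 - t by lra.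
move: p0; rewrite le_eqVlt => /predU1P[<-|p0]; first by rewrite !powRr0; lra.
have pV z : 0 <= z -> (z `^ p) `^ p^-1 = z.
  by move=> z0; rewrite -powRrM mulfV ?gt_eqF// powRr1.
have := @convexR_le _ _ _ (@convex_powR R p^-1 _) t (x `^ p) (y `^ p) t01.
rewrite invf_ge1// => /(_ p1); rewrite /= !in_itv/= !powR_ge0 !pV//.
move=> /(_ isT isT) /(@ge0_ler_powR R p (ltW p0) _ _); rewrite !nnegrE.
rewrite powR_ge0 addr_ge0 ?mulr_ge0// => /(_ isT isT).
by rewrite -powRrM mulVf ?gt_eqF// powRr1// addr_ge0 ?mulr_ge0 ?powR_ge0.
Qed.

Lemma calS0_powR p : 1 <= p <= 2 -> calS0 (fun x => x `^ p).
Proof.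
move=> /andP[p1 p2]; split; last by rewrite /= powR0// gt_eqF//; lra.
split.
- move=> x y; rewrite !in_itv/= !andbT => x0 y0; apply: ge0_ler_powR => //.
  by lra.
- exact: convex_powR.
- by move=> x x0; exact: derivable_powR.
- move=> t x y; rewrite !inE/= => xI yI.
  have [x0 y0] : 0 < x /\ 0 < y by move: xI yI; rewrite !in_itv/= !andbT.
  have t01 : 0 <= t%:num <= 1 by apply/andP.
  have cI : conv t (x : R^o) y \in `]0, +oo[.
    rewrite convRE in_itv/= andbT /unstable.onem.
    have /andP[t0 t1] := t01.
    by nra.
  rewrite !convRE in cI *.
  rewrite !powR_derive1//.
  have := @concave_powR (p - 1) t%:num x y _ t01 (ltW x0) (ltW y0).
  move=> /(_ ltac:(lra)); rewrite /unstable.onem; nra.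
Qed.
End Powers.

Unset Implicit Arguments.

(** * The inequalities in an inner product space *)

Theorem corollary26 (R : realType) (k : scalar_kind)
    (V : lmodType (scalar_field R k)) (ip : {dot V for (@scalar_conj R k)})
    (u v : V) :
  let nrm := ipnorm ip in
  [/\ forall tau : R -> R, calS0 tau ->
        tau (nrm u) - tau (nrm v) <=
          nrm (u - v) * deriv_ext tau (nrm (u + v)),
      forall alpha : R, 1 <= alpha <= 2 ->
        nrm u `^ alpha - nrm v `^ alpha <=
          alpha * 2 `^ (1 - alpha) * nrm (u - v) * nrm (u + v) `^ (alpha - 1),
      forall tau : R -> R, calS0 tau ->
        tau (nrm (u + v)) + tau (nrm (u - v)) <=
          2 * tau (nrm u) + 2 * tau (nrm v) &
      forall alpha : R, 1 <= alpha <= 2 ->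
        nrm (u + v) `^ alpha + nrm (u - v) `^ alpha <=
          2 * nrm u `^ alpha + 2 * nrm v `^ alpha].
Proof.
move=> nrm.
have nrm0 w : 0 <= nrm w by exact: sqrtr_ge0.
have para := ipnorm_parallelogram ip u v.
have polar := ipnorm_polarization_le ip u v.
rewrite -/nrm in para polar.
have quadruple tau : calS0 tau -> 0 < nrm (u + v) ->
    tau (nrm u) - tau (nrm v) <=
    nrm (u - v) * (tau^`())%classic (nrm (u + v) / 2).
  by move=> [Stau _] s0; exact: calS_quadruple.
have degenerate : nrm (u + v) = 0 -> nrm u = nrm v.
  by exact: eq_sides para polar.
have par tau : calS0 tau ->
    tau (nrm (u + v)) + tau (nrm (u - v)) <=
    2 * tau (nrm u) + 2 * tau (nrm v).
  by move=> [Stau tau0]; exact: calS0_parallelogram.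
split=> [tau Stau|alpha al|//|alpha al]; last exact: par (calS0_powR al).
- have [s0|s0] := eqVneq (nrm (u + v)) 0.
    by rewrite (degenerate s0) subrr mulr_ge0// deriv_ext_ge0//; case: Stau.
  have spos : 0 < nrm (u + v) by rewrite lt_def s0 nrm0.
  apply: (le_trans (quadruple _ Stau spos)).
  rewrite /deriv_ext (negbTE s0) ler_wpM2l// calS_derive_ndecr//; [|lra..].
  by case: Stau.
- have al0 : 0 <= alpha by lra.
  have [s0|s0] := eqVneq (nrm (u + v)) 0.
    by rewrite (degenerate s0) subrr !mulr_ge0 ?powR_ge0.
  have spos : 0 < nrm (u + v) by rewrite lt_def s0 nrm0.
  apply: (le_trans (quadruple _ (calS0_powR al) spos)).
  rewrite powR_derive1 ?in_itv/= ?andbT ?divr_gt0//.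
  rewrite powRM ?invr_ge0// -(powR_inv1 (ler0n _ 2)) -powRrM mulN1r opprB.
  by rewrite le_eqVlt; apply/orP; left; apply/eqP; ring.
Qed.
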